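(* Let $K$ be a similarity kernel on $([0,1],\lambda)$, with $\lambda$ Lebesgue measure, and with typicality function $\tau(u)=\int_0^1K(u,u')\,du'$. For $n\in\mathbb{N}$ let $I_i^{(n)}:=[(i-1)/n,i/n)$ for $i=1,\dots,n$, let $p^{(n)}$ be the uniform probability vector on $\{1,\dots,n\}$, and define $n\times n$ matrices by $$\widetilde K^{(n)}_{ij}:=n^2\int_{I_i^{(n)}\times I_j^{(n)}}K(s,t)\,ds\,dt,\qquad K^{(n)}_{ij}:=\begin{cases}\widetilde K^{(n)}_{ij},& i\ne j,\\ 1,& i=j.\end{cases}$$ Then $$H_{\widetilde K^{(n)}}(p^{(n)})\to H_K(\lambda)\quad\text{as }n\to\infty,$$ where the limit holds in $\mathbb{R}\cup\{+\infty\}$. If in addition $\tau(u)\ge\varepsilon$ for almost every $u$ for some $\varepsilon>0$, then the same convergence holds with the diagonal-repaired matrices $K^{(n)}$, i.e. $H_{K^{(n)}}(p^{(n)})\to H_K(\lambda)$, and moreover $$0\le H_{\widetilde K^{(n)}}(p^{(n)})-H_{K^{(n)}}(p^{(n)})\le\frac{1}{\varepsilon n}.$$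
   Context: A similarity kernel on $[0,1]$ is a measurable (with respect to the product Borel $\sigma$-algebra) symmetric map $K:[0,1]^2\to[0,1]$ with $K(u,u)=1$ for all $u$. Its entropy is $H_K(\lambda):=\int_0^1-\log\tau(u)\,du\in[0,\infty]$. For a matrix $A\in[0,1]^{n\times n}$ and a probability vector $p$, $H_A(p):=-\sum_i p_i\log\bigl((Ap)_i\bigr)$, where $(Ap)_i=\sum_jA_{ij}p_j$; here the diagonal of $A$ need not equal $1$. The convention $-\log 0:=+\infty$ is used throughout. *)

(* Defs.v *)
From HB Require Import structures.
From mathcomp Require Import all_boot all_order all_algebra.
From mathcomp Require Import all_classical all_reals all_analysis.

Set Implicit Arguments.
Unset Strict Implicit.
Unset Printing Implicit Defensive.

Import Order.TTheory GRing.Theory Num.Theory.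
Import numFieldNormedType.Exports.

Local Open Scope classical_set_scope.
Local Open Scope ring_scope.

Section SimilarityKernels.
Context {R : realType}.

Local Notation mu := (@lebesgue_measure R).

(* A map on [0,1]^2 is represented by a function on R * R of which only the
   values on the unit square matter. *)
Record similarity_kernel (K : R * R -> R) : Prop := SimilarityKernel {
  kernel_measurable : measurable_fun (`[0 : R, 1 : R] `*` `[0 : R, 1 : R]) K ;
  kernel_range : forall u v : R, u \in `[0, 1] -> v \in `[0, 1] -> 0 <= K (u, v) <= 1 ;
  kernel_sym : forall u v : R, u \in `[0, 1] -> v \in `[0, 1] -> K (u, v) = K (v, u) ;
  kernel_diag : forall u : R, u \in `[0, 1] -> K (u, u) = 1 }.

Definition typicality (K : R * R -> R) (u : R) : \bar R :=
  (\int[mu]_(v in `[0%R, 1%R]) (K (u, v))%:E)%E.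

(* [lne 0 = -oo], so that [- lne 0 = +oo]. *)
Definition kernel_entropy (K : R * R -> R) : \bar R :=
  (\int[mu]_(u in `[0%R, 1%R]) - lne (typicality K u))%E.

(* A term with [p i 0 = 0] contributes [0 * (-oo) = 0]. *)
Definition matrix_entropy n (A : 'M[R]_n) (p : 'cV[R]_n) : \bar R :=
  (- \sum_(i < n) (p i ord0)%:E * lne ((A *m p) i ord0)%:E)%E.

Definition uniform_vector n : 'cV[R]_n := const_mx n%:R^-1.

(* Ordinals count from 0: the i-th cell is [i/n, (i+1)/n). *)
Definition cell n (i : 'I_n) : set R := `[i%:R / n%:R, i.+1%:R / n%:R[.

Definition averaged_matrix (K : R * R -> R) n : 'M[R]_n :=
  \matrix_(i, j) (n%:R ^+ 2 * \int[(mu \x mu)%E]_(z in cell i `*` cell j) K z).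

Definition repaired_matrix (K : R * R -> R) n : 'M[R]_n :=
  \matrix_(i, j) if i == j then 1 else averaged_matrix K n i j.

End SimilarityKernels.

(* Main.v *)
Require Import Defs.
From HB Require Import structures.
From mathcomp Require Import all_boot all_order all_algebra.
From mathcomp Require Import all_classical all_reals all_analysis.
From mathcomp Require Import measurable_realfun.
From mathcomp Require Import ring lra.
Set Implicit Arguments.
Unset Strict Implicit.
Unset Printing Implicit Defensive.
Import Order.TTheory GRing.Theory Num.Theory.
Import numFieldNormedType.Exports.
Local Open Scope classical_set_scope.
Local Open Scope ring_scope.

(** Write [tau] for the typicality function. By Fubini, the i-th coordinate of
the averaged matrix applied to the uniform vector is the mean of [tau] over the
i-th cell, so the discrete entropy is the integral over [0, 1] of [- ln] of the
step function obtained by replacing [tau] with its mean on each cell. The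
convergence is then a statement about one measurable function with values in
[0, 1], and it follows from two one-sided bounds, both valid when the limit is
[+oo].

- Upper bound ([averaged_entropy_le]): since [- ln] is convex, Jensen's
  inequality on each cell ([Nlne_cell_mean_le]) shows that no discrete entropy
  exceeds the continuous one.
- Lower bound ([integral_Nlne_le_limn_einf]): the cell containing a point
  shrinks nicely to it, so by Lebesgue differentiation the step functions
  converge to [tau] almost everywhere; [- ln] is nonnegative on [0, 1] and
  continuous up to its value [+oo] at 0, and Fatou's lemma gives that the
  continuous entropy is at most the limit inferior of the discrete ones.

Repairing the diagonal replaces an entry in [0, 1] by 1, which raises each
coordinate of the matrix-vector product by at most 1/n. When [tau >= eps]
almost everywhere these coordinates are at least [eps], where [ln] has slope at
most [1 / eps]; hence each logarithm, and therefore the average of the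
logarithms, grows by at most [1 / (eps * n)] ([entropy_gap]). The convergence
of the repaired entropies follows by squeezing. *)

(** * Cells of the uniform partition *)

Section Cells.
Context {R : realType}.
Local Notation mu := (@lebesgue_measure R).
Implicit Types f : R -> \bar R.

Lemma measurable_cell n (i : 'I_n) : measurable (cell i : set R).
Proof. exact: measurable_itv. Qed.

Lemma cell_subset n (i : 'I_n) : cell i `<=` `[0 : R, 1].
Proof.
move=> x; rewrite /cell /= !in_itv /= => /andP[ix xi]; apply/andP; split.
  by apply: le_trans ix; rewrite divr_ge0.
apply/ltW/(lt_le_trans xi); rewrite ler_pdivrMr ?mul1r ?ler_nat //.
by rewrite ltr0n; case: n i ix xi => [[]|].
Qed.

Lemma bigcup_cell n : \big[setU/set0]_(i < n.+1) cell i = `[0 : R, 1[%classic.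
Proof.
rewrite -bigcup_mkord_ord; apply/seteqP; split=> x /=.
  move=> [i /= lin]; rewrite /cell /= !in_itv/= inordK // => /andP[ix xi].
  rewrite (le_trans _ ix) ?divr_ge0//=; apply: (lt_le_trans xi).
  by rewrite ler_pdivrMr ?ltr0n// mul1r ler_nat.
rewrite in_itv /= => /andP[x0 x1].
have xn0 : 0 <= x * n.+1%:R by rewrite mulr_ge0.
have /andP[kx xk] := truncn_itv xn0.
have kn : (Num.truncn (x * n.+1%:R)%R < n.+1)%N.
  by rewrite -(ltr_nat R) (le_lt_trans kx)// gtr_pMl.
exists (Num.truncn (x * n.+1%:R)%R) => //=.
by rewrite /cell/= in_itv/= inordK// ler_pdivrMr// kx /= ltr_pdivlMr.
Qed.

Lemma cell_cover n (x : R) : `[0 : R, 1[%classic x -> exists i : 'I_n.+1, cell i x.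
Proof. by rewrite -(bigcup_cell n) -bigcup_mkord_ord => -[i /= _]; exists (inord i). Qed.

Lemma cell_inj n (i j : 'I_n) (x : R) : cell i x -> cell j x -> i = j.
Proof.
case: n i j => [[]//|n] i j.
rewrite /cell /= !in_itv/= !ler_pdivrMr ?ltr_pdivlMr// => /andP[ix xi] /andP[jx xj].
apply: val_inj; apply/eqP; rewrite eqn_leq; apply/andP; split; rewrite -ltnS -(ltr_nat R).
  exact: le_lt_trans ix xj.
exact: le_lt_trans jx xi.
Qed.

Lemma lebesgue_measure_cell n (i : 'I_n.+1) : mu (cell i) = (n.+1%:R^-1)%:E.
Proof.
rewrite /cell lebesgue_measure_itv /= lte_fin ltr_pM2r ?invr_gt0// ltr_nat ltnSn.
by rewrite -EFinD -mulrBl -natrB// subSnn mul1r.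
Qed.

(** The point 1 lies in no cell, but it is negligible. *)
Lemma ge0_integral_cells n f :
  measurable_fun `[0 : R, 1]%classic f -> (forall x, `[0 : R, 1]%classic x -> (0 <= f x)%E) ->
  (\int[mu]_(x in `[0%R, 1%R]) f x = \sum_(i < n.+1) \int[mu]_(x in cell i) f x)%E.
Proof.
move=> mf f0.
have sub : (`[0 : R, 1[ `<=` `[0 : R, 1])%classic.
  by move=> x /=; rewrite !in_itv /= => /andP[-> /ltW].
have mf' : measurable_fun `[0 : R, 1[%classic f by exact: measurable_funS mf.
rewrite -integral_itv_bndo_bndc// -(bigcup_cell n).
rewrite ge0_integral_bigsetU ?index_enum_uniq//.
- by move=> i; exact: measurable_cell.
- apply/trivIsetP => i j _ _; apply: contra_neqP; move/eqP/set0P => [x [/cell_inj]].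
  exact.
- by rewrite bigcup_cell.
- by rewrite bigcup_cell => x /sub /f0.
Qed.

Lemma sum_cell_indic n (c : 'I_n -> \bar R) (i : 'I_n) (x : R) : cell i x ->
  (\sum_(j < n) c j * (\1_(cell j) x)%:E = c i)%E.
Proof.
move=> ix; rewrite (bigD1 i)//= indicE mem_set// mule1 big1 ?adde0// => j ji.
rewrite indicE memNset ?mule0// => jx.
by rewrite (cell_inj ix jx) eqxx in ji.
Qed.

End Cells.

(** * The extended logarithm *)

Section ExtendedLogarithm.
Context {R : realType}.

Lemma measurable_lne_comp (D : set R) (f : R -> \bar R) : measurable D -> measurable_fun D f ->
  (forall x, D x -> (0 <= f x <= 1)%E) -> measurable_fun D (fun x => lne (f x)).
Proof.
move=> mD mf f01.
have mff : measurable_fun D (fun x => fine (f x)) by exact: measurableT_comp.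
apply: (@eq_measurable_fun _ _ _ _ _
  (fun x => if 0 < fine (f x) then (ln (fine (f x)))%:E else -oo%E)).
  move=> x /set_mem /f01.
  case: (f x) => [r||] /andP[] //=; rewrite lee_fin => r0 _.
  by case: ltP.
apply: measurable_fun_if => //.
- exact: measurable_fun_ltr.
- apply/measurable_EFinP; apply: measurableT_comp => //.
  by apply: measurable_funS mff => // x [].
Qed.

(** [- ln] lies above its tangent at [c], by concavity of [ln]. The term
[c^-1 * y] stands on the right so that both sides are nonnegative for
[c <= 1] and [0 <= y <= 1], which allows integration without any
integrability condition. *)
Lemma lne_tangent (c : R) (y : \bar R) : 0 < c -> (0 <= y)%E -> y \is a fin_num ->
  ((1 - ln c)%:E <= - lne y + (c^-1)%:E * y)%E.
Proof.
move=> c0 y0 /fineK; case: y y0 => [r||] //; rewrite lee_fin => r0 _.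
have [r_gt0|r_le0] := ltP 0 r; last by rewrite le0_lneNy ?lee_fin//= addye// leey.
rewrite lne_EFin// -EFinM -EFinN -EFinD lee_fin.
have : ln (1 + (c^-1 * r - 1)) <= c^-1 * r - 1.
  by apply: le_ln1Dx; rewrite ltrBrDl subrr mulr_gt0// invr_gt0.
rewrite addrC subrK lnM ?posrE ?invr_gt0// lnV ?posrE//; lra.
Qed.

(** Continuity of the extended logarithm includes the point 0, where its value
is [-oo]; this is what makes the lower bound work when [tau] vanishes. *)
Lemma cvg_lne (u : (\bar R)^nat) (l : R) :
  u @ \oo --> l%:E -> (fun n => lne (u n)) @ \oo --> lne l%:E.
Proof.
move=> /fine_cvgP[ufin ul].
have [l0|l0] := ltP 0 l.
  rewrite lne_EFin//.
  apply: (@cvg_trans _ ((fun n => (ln (fine (u n)))%:E) @ \oo)); last first.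
    apply: cvg_EFin; first by near=> n.
    exact: (cvg_comp _ _ ul (continuous_ln l0)).
  apply: near_eq_cvg; near=> n.
  have : u n \is a fin_num by near: n.
  have : 0 < fine (u n) by near: n; exact: (cvgr_gt l ul).
  by case: (u n) => //= r r0 _; rewrite leNgt r0.
rewrite le0_lneNy ?lee_fin//; apply/cvgeNyPle => A.
near=> n.
have : u n \is a fin_num by near: n.
have : fine (u n) < expR A.
  by near: n; apply: (cvgr_lt l ul); rewrite (le_lt_trans l0)// expR_gt0.
case: (u n) => [r||]//= rA _; case: (leP r 0) => [_|r0]; first by rewrite leNye.
by rewrite lee_fin -[leRHS]expRK ler_ln ?posrE ?expR_gt0// ltW.
Unshelve. all: by end_near.
Qed.

End ExtendedLogarithm.

(** * Cell means and Jensen's inequality *)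

Section CellMeans.
Context {R : realType}.
Local Notation mu := (@lebesgue_measure R).
Implicit Types f : R -> \bar R.

Definition cell_mean f n (i : 'I_n) : \bar R :=
  (n%:R%:E * \int[mu]_(x in cell i) f x)%E.

Lemma cell_mean_cst n (i : 'I_n.+1) (c : R) : cell_mean (cst c%:E) i = c%:E.
Proof.
rewrite /cell_mean integral_cst/=; last exact: measurable_cell.
rewrite lebesgue_measure_cell.
by rewrite -!EFinM mulrCA divff ?mulr1// pnatr_eq0.
Qed.

Lemma le_cell_mean f g n (i : 'I_n) :
  measurable_fun `[0 : R, 1]%classic f -> measurable_fun `[0 : R, 1]%classic g ->
  (forall x, `[0 : R, 1]%classic x -> (0 <= f x)%E) ->
  (forall x, `[0 : R, 1]%classic x -> (0 <= g x)%E) ->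
  {ae mu, forall x, `[0 : R, 1]%classic x -> (f x <= g x)%E} ->
  (cell_mean f i <= cell_mean g i)%E.
Proof.
move=> mf mg f0 g0 fg; rewrite /cell_mean lee_wpmul2l ?lee_fin//.
apply: ae_ge0_le_integral.
- exact: measurable_cell.
- by move=> x /cell_subset /f0.
- exact: measurable_funS (@cell_subset _ _ _) mf.
- by move=> x /cell_subset /g0.
- exact: measurable_funS (@cell_subset _ _ _) mg.
- by move: fg; apply: filterS => [|x fg /cell_subset]; first exact: (ae_filter_ringOfSetsType mu).
Qed.

Lemma cell_mean_ge0 f n (i : 'I_n) :
  (forall x, `[0 : R, 1]%classic x -> (0 <= f x)%E) -> (0 <= cell_mean f i)%E.
Proof.
move=> f0; rewrite mule_ge0 ?lee_fin//; apply: integral_ge0 => x /cell_subset; exact: f0.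
Qed.

Section UnitValued.
Variable f : R -> \bar R.
Hypothesis mf : measurable_fun `[0 : R, 1]%classic f.
Hypothesis f01 : forall x, `[0 : R, 1]%classic x -> (0 <= f x <= 1)%E.

Let f0 x : `[0 : R, 1]%classic x -> (0 <= f x)%E.
Proof. by move/f01/andP => []. Qed.

Lemma cell_mean_le1 n (i : 'I_n) : (cell_mean f i <= 1)%E.
Proof.
case: n i => [[]//|n] i; rewrite -(cell_mean_cst i 1).
apply: le_cell_mean => //; apply/aeW => x /f01 /andP[_]; exact.
Qed.

Lemma cell_mean_fin_num n (i : 'I_n) : cell_mean f i \is a fin_num.
Proof.
rewrite fin_numElt (lt_le_trans _ (cell_mean_ge0 i f0)) ?ltNyr//=.
by rewrite (le_lt_trans (cell_mean_le1 i)) ?ltry.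
Qed.

Lemma measurable_Nlne : measurable_fun `[0 : R, 1]%classic (fun x => - lne (f x))%E.
Proof. by apply: measurableT_comp => //; exact: measurable_lne_comp. Qed.

Lemma Nlne_ge0 x : `[0 : R, 1]%classic x -> (0 <= - lne (f x))%E.
Proof. by move=> /f01 /andP[_ f1]; rewrite oppe_ge0 lne_le0. Qed.

(** Jensen's inequality for [- ln]: integrate the tangent inequality at the
mean [a] of [f]. When [a = 0] there is no tangent at [a]; instead, the tangents
at [expR (- M)] bound the right-hand side below by every [1 + M], so that it is
[+oo] like the left-hand side. *)
Lemma Nlne_cell_mean_le n (i : 'I_n.+1) :
  (- lne (cell_mean f i) <= cell_mean (fun x => - lne (f x)) i)%E.
Proof.
have tangent c : 0 < c -> c <= 1 -> ((1 - ln c)%:E <=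
    cell_mean (fun x => - lne (f x)) i + (c^-1)%:E * cell_mean f i)%E.
  move=> c0 c1; have lc : ln c <= 0 by rewrite ln_le0.
  have c'0 : 0 <= c^-1 by rewrite invr_ge0 ltW.
  rewrite -(cell_mean_cst i).
  have -> : (cell_mean (fun x => - lne (f x)) i + (c^-1)%:E * cell_mean f i =
    cell_mean (fun x => - lne (f x) + (c^-1)%:E * f x) i)%E.
    have sub := @cell_subset R _ i.
    rewrite /cell_mean ge0_integralD//=.
    - rewrite ge0_integralZl_EFin//.
      + rewrite [RHS]ge0_muleDr; first by rewrite [in RHS]muleCA.
          by apply: integral_ge0 => x /sub; exact: Nlne_ge0.
        by rewrite mule_ge0//; apply: integral_ge0 => x /sub /f0.
      + exact: measurable_cell.
      + by move=> x /sub /f0.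
      + exact: measurable_funS sub mf.
    - exact: measurable_cell.
    - by move=> x /sub; exact: Nlne_ge0.
    - exact: measurable_funS sub measurable_Nlne.
    - by move=> x /sub /f0 ?; rewrite mule_ge0.
    - by apply: measurable_funeM; exact: measurable_funS sub mf.
  apply: le_cell_mean => //.
  - apply: emeasurable_funD; first exact: measurable_Nlne.
    exact: measurable_funeM.
  - by move=> x _; rewrite lee_fin; lra.
  - by move=> x x01; rewrite adde_ge0 ?Nlne_ge0// mule_ge0 ?f0.
  - apply/aeW => x x01; apply: lne_tangent => //; first exact: f0.
    have /andP[? f1] := f01 x01.
    by rewrite ge0_fin_numE// (le_lt_trans f1) ?ltry.
have := cell_mean_ge0 i f0; have := cell_mean_le1 i; have := cell_mean_fin_num i.
case: (cell_mean f i) tangent => [a||] // tangent _.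
rewrite !lee_fin => a1; rewrite le_eqVlt => /predU1P[aE|a0].
- rewrite -aE le0_lneNy// leye_eq; apply/eqP/eqyP => M M0.
  have := tangent (expR (- M)) (expR_gt0 _).
  rewrite expRK -aE -EFinM mulr0 adde0 expR_le1 => /(_ _)/(le_trans _).
  by apply; rewrite ?lee_fin; lra.
- have := tangent _ a0 a1.
  rewrite -EFinM mulVf ?gt_eqF// lne_EFin//.
  rewrite -leeBlDr// -EFinB => /(le_trans _); apply; rewrite lee_fin; lra.
Qed.

End UnitValued.

End CellMeans.

(** * Lebesgue differentiation along cells *)

Section FloorCells.
Context {R : realType}.
Local Notation mu := (@lebesgue_measure R).

(** Lebesgue differentiation asks for nicely shrinking sets at every real point,
so the cell containing a point is extended to the whole line. *)
Definition floor_cell (x : R) (n : nat) : set R :=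
  `[(Num.floor (x * n.+1%:R))%:~R / n.+1%:R,
    (Num.floor (x * n.+1%:R) + 1)%:~R / n.+1%:R[%classic.

Lemma floor_cellE (x : R) n (i : 'I_n.+1) : cell i x -> floor_cell x n = cell i.
Proof.
rewrite /floor_cell /cell /= in_itv/= ler_pdivrMr ?ltr_pdivlMr// => /andP[ix xi].
have -> : Num.floor (x * n.+1%:R) = i%:Z.
  by apply: floor_def; rewrite intrD1 -!pmulrn natr1 ix.
by rewrite intrD1 -!pmulrn natr1.
Qed.

(** The cell at step n lies in the ball of radius 1/(n+1) around each of its
points, and its measure is half that of the ball. *)
Lemma nicely_shrinking_floor_cell (x : R) : nicely_shrinking x (floor_cell x).
Proof.
have r0 n : 0 < n.+1%:R^-1 :> R by rewrite invr_gt0.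
split=> [n|]; first exact: measurable_itv.
exists (2%R, fun n => PosNum (r0 n)); split => //= [|n z|n].
- exact: cvg_harmonic.
- rewrite /floor_cell /= in_itv /= /ball /=.
  have /andP[kx xk] := floor_itv (x * n.+1%:R).
  rewrite ler_pdivrMr ?ltr_pdivlMr// => /andP[kz zk].
  rewrite intrD1 in xk zk.
  rewrite -(ltr_pM2r (ltr0Sn R n)) mulVf ?pnatr_eq0// -[X in _ * X < _]gtr0_norm//.
  rewrite -normrM mulrBl ltr_norml; apply/andP; split; lra.
- rewrite (lebesgue_measure_ball _ (ltW _))//.
  rewrite /floor_cell lebesgue_measure_itv /= lte_fin ltr_pM2r// ltr_int ltzD1 lexx.
  by rewrite -EFinD -mulrBl intrD1 addrC addKr mul1r -EFinM lee_fin mulr_natl.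
Qed.

End FloorCells.

(** * The lower bound *)

Section Fatou.
Context {R : realType}.
Local Notation mu := (@lebesgue_measure R).
Variable f : R -> \bar R.
Hypothesis mf : measurable_fun `[0 : R, 1]%classic f.
Hypothesis f01 : forall x, `[0 : R, 1]%classic x -> (0 <= f x <= 1)%E.

Lemma fin_num_unit x : `[0 : R, 1]%classic x -> f x \is a fin_num.
Proof.
by move=> /f01/andP[f0 f1]; rewrite ge0_fin_numE// (le_lt_trans f1) ?ltry.
Qed.

(** Lebesgue differentiation for the function [f] extended by 0 outside [0, 1].
The sequence [c] is only specified through the cell containing [x] at each
step: this avoids naming that cell as an ordinal that depends on [x]. *)
Lemma cell_mean_cvg_ae : {ae mu, forall x, forall c : (\bar R)^nat,
  (forall n (i : 'I_n.+1), cell i x -> c n = cell_mean f i) ->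
  `[0 : R, 1[%classic x -> c @ \oo --> f x}.
Proof.
pose g : R -> R := (fine \o f) \_ `[0 : R, 1]%classic.
have gE x : `[0 : R, 1]%classic x -> (g x)%:E = f x.
  by move=> x01; rewrite /g patchE mem_set//= fineK// fin_num_unit.
have mg : measurable_fun setT g.
  by apply/(measurable_restrictT _ _).1 => //; exact: measurableT_comp.
have locg : locally_integrable setT g.
  apply: open_integrable_locally; first exact: openT.
  have -> : EFin \o g = (EFin \o (fine \o f)) \_ `[0 : R, 1]%classic.
    by apply/funext => x; rewrite /g /= !patchE; case: ifP.
  apply/(integrable_mkcond _ _).1 => //.
  apply: measurable_bounded_integrable => //.
  - by rewrite /= lebesgue_measure_itv /= lte_fin ltr01 -EFinD ltry.
  - exact: measurableT_comp.
  - exists 1; split => // M M1 x /= x01.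
    have := f01 x01; have := fin_num_unit x01; case: (f x) => [r||]//= _.
    rewrite !lee_fin => /andP[r0 r1]; rewrite ger0_norm//; lra.
have := lebesgue_differentiation locg.
apply: filterS; first exact: (ae_filter_ringOfSetsType mu).
move=> x gx c cE x01.
have x01' : `[0 : R, 1]%classic x.
  by move: x01; rewrite /= !in_itv /= => /andP[-> /ltW].
have := nice_lebesgue_differentiation nicely_shrinking_floor_cell locg gx.
rewrite gE//; apply: cvg_trans; apply: near_eq_cvg; near=> n.
have [i ix] := cell_cover n x01.
rewrite (floor_cellE ix) (cE _ _ ix) /cell_mean lebesgue_measure_cell.
rewrite inver gt_eqF ?invr_gt0// invrK; congr *%E.
apply: eq_integral => y /set_mem /cell_subset y01; exact: gE.
Unshelve. all: by end_near.
Qed.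

Definition step_entropy n (x : R) : \bar R :=
  (\sum_(i < n.+1) (- lne (cell_mean f i)) * (\1_(cell i) x)%:E)%E.

Let Nlne_mean_ge0 n (i : 'I_n) : (0 <= - lne (cell_mean f i))%E.
Proof. by rewrite oppe_ge0 lne_le0; exact: cell_mean_le1. Qed.

Lemma step_entropyE n (i : 'I_n.+1) x : cell i x ->
  step_entropy n x = (- lne (cell_mean f i))%E.
Proof. exact: (@sum_cell_indic _ _ (fun i => - lne (cell_mean f i))%E). Qed.

Lemma step_entropy_ge0 n x : (0 <= step_entropy n x)%E.
Proof. by apply: sume_ge0 => i _; rewrite mule_ge0// lee_fin. Qed.

Lemma measurable_step_entropy n : measurable_fun setT (step_entropy n).
Proof.
apply: emeasurable_sum => i; apply: measurable_funeM.
by apply/measurable_EFinP; apply: measurable_indic; exact: measurable_cell.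
Qed.

Lemma integral_step_entropy n : (\int[mu]_(x in `[0%R, 1%R]) step_entropy n x =
  \sum_(i < n.+1) (n.+1%:R^-1)%:E * - lne (cell_mean f i))%E.
Proof.
rewrite (@ge0_integral_cells _ n).
- apply: eq_bigr => i _; rewrite -(lebesgue_measure_cell i) muleC -integral_cst.
    by apply: eq_integral => x /set_mem /step_entropyE ->.
  exact: measurable_cell.
- exact: measurable_funTS (measurable_step_entropy n).
- by move=> x _; exact: step_entropy_ge0.
Qed.

(** Fatou's lemma for the step functions [step_entropy n], which converge to
[- lne \o f] almost everywhere and have the sums on the right as integrals. *)
Lemma integral_Nlne_le_limn_einf : (\int[mu]_(x in `[0%R, 1%R]) - lne (f x) <=
  limn_einf (fun n => \sum_(i < n.+1) (n.+1%:R^-1)%:E * - lne (cell_mean f i)))%E.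
Proof.
have mstep n : measurable_fun `[0 : R, 1]%classic (step_entropy n).
  exact: measurable_funTS (measurable_step_entropy n).
rewrite [X in limn_einf X](_ : _ =
    (fun n => \int[mu]_(x in `[0%R, 1%R]) step_entropy n x)%E); last first.
  by apply/funext => n; rewrite integral_step_entropy.
apply: le_trans (fatou mu _ mstep _) => //; last first.
  by move=> n x _; exact: step_entropy_ge0.
have sub : (`[0 : R, 1[ `<=` `[0 : R, 1])%classic.
  by move=> x /=; rewrite !in_itv /= => /andP[-> /ltW].
have minf : measurable_fun `[0 : R, 1]%classic (fun x => limn_einf (step_entropy ^~ x)).
  apply: measurableT_comp => //; apply: measurable_fun_limn_esup => // n.
  exact: measurableT_comp.
(* The point 1 lies in no cell, so the comparison is made on [0, 1[. *)
rewrite -!integral_itv_bndo_bndc//; first last.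
- exact: measurable_funS sub (measurable_Nlne mf f01).
- exact: measurable_funS sub minf.
apply: ae_ge0_le_integral => //.
- by move=> x /sub; exact: Nlne_ge0.
- exact: measurable_funS sub (measurable_Nlne mf f01).
- move=> x _; rewrite limn_einf_lim; apply: lime_ge; first exact: is_cvg_einfs.
  near=> n; apply: le_ereal_inf_tmp => _ [k _ <-]; exact: step_entropy_ge0.
- exact: measurable_funS sub minf.
have := cell_mean_cvg_ae.
apply: filterS; first exact: (ae_filter_ringOfSetsType mu).
move=> x cvgx x01.
pose c n := (\sum_(i < n.+1) cell_mean f i * (\1_(cell i) x)%:E)%E.
have cE n (i : 'I_n.+1) : cell i x -> c n = cell_mean f i.
  exact: (@sum_cell_indic _ _ (fun i => cell_mean f i)).
have := cvgx _ cE x01; rewrite -(fineK (fin_num_unit (sub _ x01))) => /cvg_lne/cvgeN.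
rewrite fineK ?fin_num_unit//; last exact: sub.
have -> : (fun n => - lne (c n))%E = step_entropy ^~ x.
  apply/funext => n.
  have [i ix] := cell_cover n x01.
  by rewrite (cE _ _ ix) (step_entropyE ix).
by move=> /cvg_limn_einf_sup[-> _].
Unshelve. all: by end_near.
Qed.

End Fatou.

(** * Kernel averages *)

Section KernelAverages.
Context {R : realType}.
Local Notation mu := (@lebesgue_measure R).
Variable K : R * R -> R.
Hypothesis hK : similarity_kernel K.

Let K01 x y : `[0 : R, 1]%classic x -> `[0 : R, 1]%classic y -> (0 <= (K (x, y))%:E <= 1)%E.
Proof. by move=> x01 y01; rewrite !lee_fin; exact: (kernel_range hK). Qed.

Definition section_integral (D : set R) (x : R) : \bar R :=
  (\int[mu]_(y in D) (K (x, y))%:E)%E.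

Section Rectangles.
Variables C D : set R.
Hypotheses (mC : measurable C) (mD : measurable D).
Hypotheses (C01 : C `<=` `[0 : R, 1]) (D01 : D `<=` `[0 : R, 1]).

(** Only the values of [K] on the unit square are controlled, so [K] is extended
by 0 outside the rectangle before Tonelli's theorem is applied. *)
Let Krect := (EFin \o K) \_ (C `*` D).

Let mKrect : measurable_fun setT Krect.
Proof.
apply/(measurable_restrictT _ _).1; first exact: measurableX.
apply/measurable_EFinP; apply: measurable_funS (kernel_measurable hK).
  by apply: measurableX; exact: measurable_itv.
by move=> [x y] [/= /C01 ? /D01 ?]; split.
Qed.

Let Krect_ge0 z : (0 <= Krect z)%E.
Proof.
rewrite /Krect patchE; case: ifPn => // /set_mem; case: z => x y [/= /C01 x01 /D01 y01].
by case/andP: (K01 x01 y01).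
Qed.

Let KrectE x y : C x -> Krect (x, y) = ((fun y => (K (x, y))%:E) \_ D) y.
Proof. by move=> Cx; rewrite /Krect !patchE in_setX/= mem_set. Qed.

Let fubini_F_Krect : fubini_F mu Krect = (section_integral D) \_ C.
Proof.
apply/funext => x; rewrite /fubini_F patchE; case: ifPn => [/set_mem Cx|/negP Cx].
  by rewrite /section_integral [RHS]integral_mkcond; apply: eq_integral => y _; exact: KrectE.
apply: integral0_eq => y _; rewrite /Krect patchE in_setX /=.
by case: ifPn => // /andP[].
Qed.

Lemma measurable_section_integral : measurable_fun C (section_integral D).
Proof.
apply/(measurable_restrictT _ _).2 => //; rewrite -fubini_F_Krect.
exact: measurable_fun_fubini_tonelli_F.
Qed.

Lemma measurable_kernel_section x : C x -> measurable_fun D (fun y => (K (x, y))%:E).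
Proof.
move=> Cx; apply/(measurable_restrictT _ _).2 => //.
have -> : (fun y => (K (x, y))%:E) \_ D = (fun y => Krect (x, y)).
  by apply/funext => y; rewrite KrectE.
exact: measurable_fun_pair2.
Qed.

Lemma integral_rectangle : (\int[(mu \x mu)%E]_(z in C `*` D) (K z)%:E =
  \int[mu]_(x in C) section_integral D x)%E.
Proof.
rewrite integral_mkcond; transitivity (\int[(mu \x mu)%E]_z Krect z)%E; first by [].
rewrite fubini_tonelli1// [RHS]integral_mkcond; apply: eq_integral => x _.
exact: (congr1 (fun F => F x) fubini_F_Krect).
Qed.

End Rectangles.

Lemma section_integral_ge0 D x : D `<=` `[0 : R, 1] -> `[0 : R, 1]%classic x ->
  (0 <= section_integral D x)%E.
Proof.
by move=> D01 x01; apply: integral_ge0 => y /D01 y01; case/andP: (K01 x01 y01).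
Qed.

Lemma section_integral_le D x : measurable D -> D `<=` `[0 : R, 1] ->
  `[0 : R, 1]%classic x -> (section_integral D x <= mu D)%E.
Proof.
move=> mD D01 x01; rewrite -[leRHS]mul1e -integral_cst//.
apply: ge0_le_integral => //.
- by move=> y /D01 y01; case/andP: (K01 x01 y01).
- exact: (measurable_kernel_section (measurable_itv `[0, 1])).
- by move=> y /D01 y01; case/andP: (K01 x01 y01).
Qed.

Lemma measurable_typicality : measurable_fun `[0 : R, 1]%classic (typicality K).
Proof. by apply: measurable_section_integral => //; exact: measurable_itv. Qed.

Lemma typicality01 x : `[0 : R, 1]%classic x -> (0 <= typicality K x <= 1)%E.
Proof.
move=> x01; rewrite section_integral_ge0//=.
apply: le_trans (section_integral_le _ _ x01) _ => //.
by rewrite lebesgue_measure_itv /= lte_fin ltr01 -EFinD subr0.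
Qed.

Lemma cell_mean_section01 n (i j : 'I_n.+1) :
  (0 <= cell_mean (section_integral (cell j)) i <= (n.+1%:R^-1)%:E)%E.
Proof.
have sub := @cell_subset R _ j; have mj := measurable_cell (R := R) j.
have pos x : `[0 : R, 1]%classic x -> (0 <= section_integral (cell j) x)%E.
  exact: section_integral_ge0.
rewrite cell_mean_ge0//= -(cell_mean_cst i) le_cell_mean//.
  by apply: measurable_section_integral => //; exact: measurable_itv.
  by move=> x _; rewrite lee_fin invr_ge0.
apply/aeW => x x01; rewrite -(lebesgue_measure_cell j).
exact: section_integral_le.
Qed.

Lemma averaged_matrixE n (i j : 'I_n.+1) : ((averaged_matrix K n.+1 i j)%:E =
  n.+1%:R%:E * cell_mean (section_integral (cell j)) i)%E.
Proof.
have /andP[m0 m1] := cell_mean_section01 i j.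
have mean_fin : cell_mean (section_integral (cell j)) i \is a fin_num.
  by rewrite ge0_fin_numE// (le_lt_trans m1) ?ltry.
have intE : (\int[mu]_(x in cell i) section_integral (cell j) x =
    (n.+1%:R^-1)%:E * cell_mean (section_integral (cell j)) i)%E.
  by rewrite /cell_mean muleA -EFinM mulVf ?pnatr_eq0// mul1e.
rewrite mxE EFinM /Rintegral integral_rectangle;
  [|exact: measurable_cell|exact: measurable_cell|exact: cell_subset|exact: cell_subset].
rewrite fineK; last by rewrite intE fin_numM.
by rewrite expr2 EFinM -muleA.
Qed.

Lemma averaged_matrix01 n (i j : 'I_n.+1) : 0 <= averaged_matrix K n.+1 i j <= 1.
Proof.
have /andP[m0 m1] := cell_mean_section01 i j.
rewrite -!lee_fin averaged_matrixE mule_ge0 ?lee_fin//=.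
apply: le_trans (lee_wpmul2l _ m1) _; first by rewrite lee_fin.
by rewrite -EFinM divff ?pnatr_eq0.
Qed.

(** The cells partition [0, 1] up to a point, so summing the averages along a
row integrates the kernel over the whole second variable. *)
Lemma averaged_matrix_row n (i : 'I_n.+1) :
  ((averaged_matrix K n.+1 *m uniform_vector n.+1) i ord0)%:E =
  cell_mean (typicality K) i.
Proof.
rewrite mxE -sumEFin.
under eq_bigr do rewrite [uniform_vector _ _ _]mxE EFinM averaged_matrixE muleC
  muleA -EFinM mulVf ?pnatr_eq0// mul1e.
rewrite /cell_mean -ge0_sume_distrr; last first.
  move=> j _; apply: integral_ge0 => x /cell_subset; apply: section_integral_ge0.
  exact: cell_subset.
congr *%E; rewrite -ge0_integral_sum.
- apply: eq_integral => x /set_mem /cell_subset x01.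
  rewrite /typicality (@ge0_integral_cells _ n)//.
    exact: (measurable_kernel_section (measurable_itv `[0, 1])).
  by move=> y y01; case/andP: (K01 x01 y01).
- exact: measurable_cell.
- move=> j; apply: measurable_section_integral.
  + exact: measurable_cell.
  + exact: measurable_cell.
  + exact: cell_subset.
  + exact: cell_subset.
- by move=> j x /cell_subset x01; apply: section_integral_ge0 => //; exact: cell_subset.
Qed.

End KernelAverages.

(** * Entropy for the uniform vector *)

Section MatrixEntropy.
Context {R : realType}.

Lemma uniform_row_le1 n (A : 'M[R]_n.+1) i : (forall i j, A i j <= 1) ->
  (A *m uniform_vector n.+1) i ord0 <= 1.
Proof.
move=> A1; rewrite mxE; apply: (@le_trans _ _ (\sum_(j < n.+1) n.+1%:R^-1)).
  by apply: ler_sum => j _; rewrite mxE ler_piMl// invr_ge0.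
by rewrite sumr_const card_ord -[X in X <= _]mulr_natl divff// pnatr_eq0.
Qed.

(** The bound on the entries makes every logarithm at most 0, so that no term of
the sum is [+oo] and the opposite may be taken termwise. *)
Lemma matrix_entropy_uniform n (A : 'M[R]_n.+1) : (forall i j, A i j <= 1) ->
  matrix_entropy A (uniform_vector n.+1) = (\sum_(i < n.+1)
   (n.+1%:R^-1)%:E * - lne ((A *m uniform_vector n.+1) i ord0)%:E)%E.
Proof.
move=> A1; have lt1 i : ((n.+1%:R^-1)%:E * lne ((A *m uniform_vector n.+1) i ord0)%:E < +oo)%E.
  apply: (@le_lt_trans _ _ 0%E) => //; apply: mule_ge0_le0; first by rewrite lee_fin.
  by rewrite lne_le0 lee_fin uniform_row_le1.
have uE i : uniform_vector n.+1 i ord0 = n.+1%:R^-1 :> R by rewrite mxE.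
rewrite /matrix_entropy -sumeN; last first.
  by move=> i j _ _; rewrite !uE; apply: ltpinfty_adde_def; rewrite inE; exact: lt1.
by apply: eq_bigr => i _; rewrite uE muleN.
Qed.

Lemma repaired_matrix_row (K : R * R -> R) n (i : 'I_n.+1) :
  (repaired_matrix K n.+1 *m uniform_vector n.+1) i ord0 =
  (averaged_matrix K n.+1 *m uniform_vector n.+1) i ord0 +
  (1 - averaged_matrix K n.+1 i i) / n.+1%:R.
Proof.
have uE j : uniform_vector n.+1 j ord0 = n.+1%:R^-1 :> R by rewrite mxE.
have rE j : repaired_matrix K n.+1 i j = if i == j then 1 else averaged_matrix K n.+1 i j.
  by rewrite [LHS]mxE.
rewrite [LHS]mxE [X in _ = X + _]mxE (bigD1 i)//= [in RHS](bigD1 i)//= rE eqxx !uE.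
rewrite (eq_bigr (fun j => averaged_matrix K n.+1 i j * uniform_vector n.+1 j ord0)).
  ring.
by move=> j ji; rewrite rE eq_sym (negbTE ji).
Qed.

End MatrixEntropy.

(** * Convergence of the entropies *)

Section Convergence.
Context {R : realType}.
Local Notation mu := (@lebesgue_measure R).
Variable K : R * R -> R.
Hypothesis hK : similarity_kernel K.

Lemma averaged_entropyE n :
  matrix_entropy (averaged_matrix K n.+1) (uniform_vector n.+1) =
  (\sum_(i < n.+1) (n.+1%:R^-1)%:E * - lne (cell_mean (typicality K) i))%E.
Proof.
rewrite matrix_entropy_uniform; first by under eq_bigr do rewrite (averaged_matrix_row hK).
by move=> i j; case/andP: (averaged_matrix01 hK i j).
Qed.

Lemma averaged_entropy_le n :
  (matrix_entropy (averaged_matrix K n.+1) (uniform_vector n.+1) <= kernel_entropy K)%E.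
Proof.
have mt := measurable_typicality hK; have t01 := typicality01 hK.
rewrite averaged_entropyE /kernel_entropy (@ge0_integral_cells _ n).
- apply: lee_sum => i _.
  apply: le_trans (lee_wpmul2l _ (Nlne_cell_mean_le mt t01 i)) _; first by rewrite lee_fin invr_ge0.
  by rewrite /cell_mean muleA -EFinM mulVf ?pnatr_eq0// mul1e.
- exact: measurable_Nlne.
- by move=> x; exact: Nlne_ge0.
Qed.

Lemma averaged_entropy_cvg :
  (fun n => matrix_entropy (averaged_matrix K n) (uniform_vector n)) @ \oo --> kernel_entropy K.
Proof.
(* Opposites turn the bounds from above and on the limit inferior into bounds
   from below and on the limit superior. *)
rewrite -cvg_shiftS -[kernel_entropy K]oppeK.
rewrite (_ : [sequence _]_n = (fun n => - - matrix_entropy (averaged_matrix K n.+1)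
    (uniform_vector n.+1))%E); last by apply/funext => n; rewrite oppeK.
apply: cvgeN; apply: limn_esup_le_cvg; last by move=> n; rewrite leeN2 averaged_entropy_le.
rewrite leeNr.
have -> : (fun n => - matrix_entropy (averaged_matrix K n.+1) (uniform_vector n.+1))%E =
    (fun n => - (\sum_(i < n.+1) (n.+1%:R^-1)%:E * - lne (cell_mean (typicality K) i)))%E.
  by apply/funext => n; rewrite averaged_entropyE.
exact: integral_Nlne_le_limn_einf (measurable_typicality hK) (typicality01 hK).
Qed.

Section TypicalityBoundedBelow.
Variable eps : R.
Hypothesis eps0 : 0 < eps.
Hypothesis tau_ge :
  {ae mu, forall u : R, u \in `[0, 1] -> (eps%:E <= typicality K u)%E}.

Let a n (i : 'I_n.+1) := (averaged_matrix K n.+1 *m uniform_vector n.+1) i ord0.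
Let b n (i : 'I_n.+1) := (repaired_matrix K n.+1 *m uniform_vector n.+1) i ord0.

Lemma averaged_row_ge n (i : 'I_n.+1) : eps <= a i.
Proof.
rewrite -lee_fin /a averaged_matrix_row// -(cell_mean_cst i eps).
apply: le_cell_mean => //.
- exact: measurable_typicality.
- by move=> x _; rewrite lee_fin ltW.
- by move=> x /(typicality01 hK)/andP[].
Qed.

Lemma repaired_row_bounds n (i : 'I_n.+1) : a i <= b i <= a i + n.+1%:R^-1.
Proof.
rewrite /b repaired_matrix_row -/(a i).
have /andP[k0 k1] := averaged_matrix01 hK i i.
rewrite lerDl lerD2l divr_ge0 ?subr_ge0//= ler_piMl ?invr_ge0//; lra.
Qed.

Lemma averaged_entropy_fin n :
  matrix_entropy (averaged_matrix K n.+1) (uniform_vector n.+1) =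
  (\sum_(i < n.+1) n.+1%:R^-1 * - ln (a i))%:E.
Proof.
rewrite matrix_entropy_uniform.
  rewrite -sumEFin; apply: eq_bigr => i _.
  by rewrite lne_EFin// (lt_le_trans eps0)// averaged_row_ge.
by move=> i j; case/andP: (averaged_matrix01 hK i j).
Qed.

Lemma repaired_entropy_fin n :
  matrix_entropy (repaired_matrix K n.+1) (uniform_vector n.+1) =
  (\sum_(i < n.+1) n.+1%:R^-1 * - ln (b i))%:E.
Proof.
rewrite matrix_entropy_uniform.
  rewrite -sumEFin; apply: eq_bigr => i _.
  have /andP[ab _] := repaired_row_bounds i.
  by rewrite lne_EFin// (lt_le_trans eps0)// (le_trans _ ab)// averaged_row_ge.
move=> i j; rewrite [repaired_matrix _ _ _ _]mxE; case: ifP => // _.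
by case/andP: (averaged_matrix01 hK i j).
Qed.

(** [ln b - ln a = ln (1 + (b - a) / a) <= (b - a) / a], where [b - a <= 1/n]
and [a >= eps]. *)
Lemma ln_row_gap n (i : 'I_n.+1) : 0 <= ln (b i) - ln (a i) <= (eps * n.+1%:R)^-1.
Proof.
have age := averaged_row_ge i; have /andP[ab ba] := repaired_row_bounds i.
have a0 : 0 < a i by exact: lt_le_trans age.
have b0 : 0 < b i by exact: lt_le_trans ab.
rewrite subr_ge0 ler_ln ?posrE// ab /=.
have -> : b i = a i * (1 + (b i - a i) / a i) by field; rewrite gt_eqF.
have d0 : 0 <= (b i - a i) / a i by rewrite divr_ge0 ?subr_ge0// ltW.
rewrite lnM ?posrE//; last by lra.
rewrite addrC addKr; apply: le_trans (le_ln1Dx _) _; first by lra.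
rewrite ler_pdivrMr// invfM mulrAC; apply: (@le_trans _ _ (n.+1%:R^-1)); first by rewrite lerBlDl.
by rewrite ler_peMl ?invr_ge0// ler_pdivlMl// mulr1.
Qed.

Lemma entropy_gap n : (0 < n)%N ->
  (0 <= matrix_entropy (averaged_matrix K n) (uniform_vector n)
        - matrix_entropy (repaired_matrix K n) (uniform_vector n)
     <= ((eps * n%:R)^-1)%:E)%E.
Proof.
case: n => // n _; rewrite averaged_entropy_fin repaired_entropy_fin -EFinB !lee_fin -sumrB.
have gapE i : n.+1%:R^-1 * - ln (a i) - n.+1%:R^-1 * - ln (b i) =
    n.+1%:R^-1 * (ln (b i) - ln (a i)) :> R by ring.
under eq_bigr do rewrite gapE.
rewrite -mulr_sumr; apply/andP; split.
  by rewrite mulr_ge0 ?invr_ge0// sumr_ge0// => i _; case/andP: (ln_row_gap i).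
rewrite ler_pdivrMl// mulr_natl.
rewrite -[X in _ *+ X]card_ord -sumr_const; apply: ler_sum => i _.
by case/andP: (ln_row_gap i).
Qed.

Lemma repaired_entropy_cvg :
  (fun n => matrix_entropy (repaired_matrix K n) (uniform_vector n)) @ \oo --> kernel_entropy K.
Proof.
have Ha : (fun n => matrix_entropy (averaged_matrix K n.+1) (uniform_vector n.+1)) @ \oo
    --> kernel_entropy K.
  by have := averaged_entropy_cvg; rewrite -cvg_shiftS.
suff : (fun n => matrix_entropy (repaired_matrix K n.+1) (uniform_vector n.+1)) @ \oo
    --> kernel_entropy K by rewrite -[X in _ -> X]cvg_shiftS.
have inv0 : (fun n => (- (eps * n.+1%:R)^-1)%:E) @ \oo --> (0%:E : \bar R).
  apply: cvg_EFin; first by near=> n.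
  rewrite -oppr0 -(mulr0 eps^-1); apply: cvgN.
  rewrite [X in X @ _](_ : _ = (fun n => eps^-1 * n.+1%:R^-1)); last first.
    by apply/funext => n; rewrite /= invfM.
  by apply: cvgMr; exact: cvg_harmonic.
have Hl : (fun n => matrix_entropy (averaged_matrix K n.+1) (uniform_vector n.+1) +
    (- (eps * n.+1%:R)^-1)%:E)%E @ \oo --> kernel_entropy K.
  by rewrite -[kernel_entropy K]adde0; apply: cvgeD Ha inv0; exact: fin_num_adde_defl.
apply: (squeeze_cvge _ Hl Ha); near=> n => /=.
have /andP[] := @entropy_gap n.+1 isT.
rewrite averaged_entropy_fin repaired_entropy_fin -EFinD -EFinB !lee_fin => gap0 gap1.
by rewrite lerBlDr -lerBlDl gap1 -subr_ge0.
Unshelve. all: by end_near. Qed.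

End TypicalityBoundedBelow.

End Convergence.

Theorem theorem7p1 (R : realType) (K : R * R -> R) (hK : similarity_kernel K) :
  (fun n : nat => matrix_entropy (averaged_matrix K n) (uniform_vector n))
    @ \oo --> kernel_entropy K
  /\
  forall eps : R, 0 < eps ->
    {ae @lebesgue_measure R, forall u : R, u \in `[0, 1] -> (eps%:E <= typicality K u)%E} ->
    (fun n : nat => matrix_entropy (repaired_matrix K n) (uniform_vector n))
      @ \oo --> kernel_entropy K
    /\
    forall n : nat, (0 < n)%N ->
      (0 <= matrix_entropy (averaged_matrix K n) (uniform_vector n)
            - matrix_entropy (repaired_matrix K n) (uniform_vector n)
         <= ((eps * n%:R)^-1)%:E)%E.
Proof.
split; first exact: averaged_entropy_cvg.
move=> eps eps0 tau_ge; split; first exact: repaired_entropy_cvg tau_ge.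
by move=> n; exact: entropy_gap.
Qed.
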